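(* Let $X$ be a one-ended, proper, periodic geodesic metric space such that every point of $X$ is at distance less than $\kappa$ from a bi-infinite bi-Lipschitz path. Let $\gamma_0=4\kappa$ and $\delta_0=\frac1{C^2+1}$, where $C\ge1$ is such that there are finitely many bi-infinite $C$-bi-Lipschitz paths $\mathfrak p_1,\dots,\mathfrak p_m$ in $X$ with the property that every point of $X$ is at distance less than $\kappa$ from $g\mathfrak p_i$ for some $g\in\mathrm{Isom}(X)$ and some $i$. Then: (1) For $\delta\le\delta_0$ and $\gamma\ge\gamma_0$, the functions $\mathrm{div}'_\gamma(n;\lambda,\delta)$ and $\mathrm{Div}'_\gamma(n;\delta)$ do not depend (up to the equivalence relation $\equiv$) on the choice of geodesics $[a,b]$ for every pair of points $a,b$. (2) For every $\delta\le\delta_0$, $\gamma\ge\gamma_0$ and $\lambda\ge2$, $$\mathrm{Div}_\gamma(n;\delta)\equiv\mathrm{Div}'_\gamma(n;\delta)\equiv\mathrm{div}_\gamma(n;\lambda,\delta)\equiv\mathrm{div}'_\gamma(n;\lambda,\delta).$$ Moreover all these functions are independent of $\delta\le\delta_0$ and $\gamma\ge\gamma_0$ (up to the equivalence relation $\equiv$). (3) For $\delta\le\delta_0$ and $\gamma\ge\gamma_0$, the function $\mathrm{Div}_\gamma(n;\delta)$ is equivalent to $\mathrm{div}'_\gamma(n;2,\delta)$ as a function in $n$; thus, in order to estimate $\mathrm{Div}_\gamma(n;\delta)$ for $\delta\le\delta_0$, it is enough to consider points $a,b,c$ where $c$ is the midpoint of a (fixed) geodesic segment connecting $a$ and $b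$.
   Context: A space is periodic if the orbit of some ball under its isometry group covers the space. Throughout $\delta\in(0,1)$, $\gamma\ge0$, $\lambda\ge2$. For $a,b,c\in X$ with $r=\mathrm{dist}(c,\{a,b\})=\min(\mathrm{dist}(c,a),\mathrm{dist}(c,b))>0$, $\mathrm{div}_\gamma(a,b,c;\delta)$ is the infimum of the lengths of paths connecting $a,b$ and avoiding the ball $B(c,\delta r-\gamma)$ (a ball of non-positive radius is empty); it is $\infty$ if no such path exists. $\mathrm{Div}_\gamma(n;\delta)$ is the supremum of $\mathrm{div}_\gamma(a,b,c;\delta)$ over all $a,b,c$ with $\mathrm{dist}(a,b)\le n$. $\mathrm{div}_\gamma(n;\lambda,\delta)$ is the supremum of $\mathrm{div}_\gamma(a,b,c;\delta)$ over all $a,b,c$ with $0\le\mathrm{dist}(a,b)\le n$ and $\lambda\,\mathrm{dist}(c,\{a,b\})\ge\mathrm{dist}(a,b)$. For every pair of points $a,b$ a geodesic $[a,b]$ joining them is chosen and fixed, such that if $x,y$ are points on a chosen geodesic $[a,b]$, the sub-geodesic $[x,y]\subseteq[a,b]$ is the one chosen for $x,y$. $\mathrm{Div}'_\gamma(n;\delta)$ and $\mathrm{div}'_\gamma(n;\lambda,\delta)$ are defined as $\mathrm{Div}_\gamma$ and $\mathrm{div}_\gamma$, but restricting $c$ to lie on the chosen geodesic $[a,b]$. Equivalence of functions: $f\preceq g$ if for some $K>1$, $f(n)\le Kg(Kn)+Kn+K$ for all $n$; $f\equiv g$ if $f\preceq g$ and $g\preceq f$. *)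

(* Defs.v *)
From HB Require Import structures.
From mathcomp Require Import all_boot all_order all_algebra.
From mathcomp Require Import all_classical all_reals all_analysis.

Set Implicit Arguments.
Unset Strict Implicit.
Unset Printing Implicit Defensive.

Import Order.TTheory GRing.Theory Num.Theory.
Import numFieldNormedType.Exports.

Local Open Scope classical_set_scope.
Local Open Scope ring_scope.

Section MetricSpaces.
Context {R : realType}.
Implicit Type X : metricType R.

Definition proper_space X : Prop :=
  forall (x : X) (r : R), compact [set y : X | mdist x y <= r].

(* Geodesic segments are unparametrized, i.e. subsets of X. *)
Definition geodesic_segment X (a b : X) (S : set X) : Prop :=
  exists f : R -> X,
    [/\ f 0 = a, f (mdist a b) = b,
        {in `[0, mdist a b] &, forall s t, mdist (f s) (f t) = `|s - t|}
      & S = f @` `[0, mdist a b]].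

Definition geodesic_space X : Prop :=
  forall a b : X, exists S, geodesic_segment a b S.

Definition is_isometry X (g : X -> X) : Prop :=
  bijective g /\ forall x y, mdist (g x) (g y) = mdist x y.

Definition periodic_space X : Prop :=
  exists (o : X) (r : R), forall x : X,
    exists g : X -> X, is_isometry g /\ (g @` ball o r) x.

Definition unbounded X (A : set X) : Prop :=
  forall (x : X) (r : R), ~ A `<=` ball x r.

(* Meant for proper geodesic spaces: there the complement of a compact set is
   open and locally path connected, so that connected and path components
   coincide, and unbounded means not relatively compact. *)
Definition one_ended X : Prop :=
  forall K : set X, compact K ->
    exists! U : set X,
      (exists x, U = connected_component (~` K) x) /\ unbounded U.

Definition bilipschitz_line X (C : R) (p : R -> X) : Prop :=
  forall s t, C^-1 * `|s - t| <= mdist (p s) (p t) <= C * `|s - t|.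

(* The metric analogue of total_variation. *)
Definition path_length X (a b : R) (p : R -> X) : \bar R :=
  ereal_sup [set (\sum_(0 <= i < size s)
                    mdist (p (nth b (a :: s) i)) (p (nth b (a :: s) i.+1)))%:E
            | s in itv_partition a b].

Definition path_avoiding X (B : set X) (a b : X) (p : R -> X) : Prop :=
  [/\ {within `[0, 1], continuous p}, p 0 = a, p 1 = b
    & forall t, t \in `[0, 1] -> ~ B (p t)].

Definition dist_pair X (c a b : X) : R := Num.min (mdist c a) (mdist c b).

(* ball c r = {y | mdist c y < r} is empty for r <= 0. *)
Definition div_at X (gamma delta : R) (a b c : X) : \bar R :=
  ereal_inf [set path_length 0 1 p | p in
    path_avoiding (ball c (delta * dist_pair c a b - gamma)) a b].

(* 0 is added so that the supremum of an empty family, taken in [0, +oo],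
   is 0 and not -oo. *)
Definition sup_div X (gamma delta : R) (P : X -> X -> X -> Prop) : \bar R :=
  ereal_sup (0%E |` [set v | exists a b c,
    [/\ 0 < dist_pair c a b, P a b c & v = div_at gamma delta a b c]]).

(* The sub-geodesic of [a, b] between x and y is the only geodesic segment from
   x to y contained in [a, b], so that inclusion is enough. *)
Definition geodesic_choice X (G : X -> X -> set X) : Prop :=
  (forall a b, geodesic_segment a b (G a b)) /\
  (forall a b x y, G a b x -> G a b y -> G x y `<=` G a b).

Section Divergence.
Variable X : metricType R.

Definition Div (gamma delta n : R) : \bar R :=
  sup_div gamma delta (fun a b _ : X => mdist a b <= n).

Definition div (gamma lambda delta n : R) : \bar R :=
  sup_div gamma delta (fun a b c : X =>
    mdist a b <= n /\ mdist a b <= lambda * dist_pair c a b).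

Variable G : X -> X -> set X.

Definition Div' (gamma delta n : R) : \bar R :=
  sup_div gamma delta (fun a b c : X => mdist a b <= n /\ G a b c).

Definition div' (gamma lambda delta n : R) : \bar R :=
  sup_div gamma delta (fun a b c : X =>
    [/\ mdist a b <= n, mdist a b <= lambda * dist_pair c a b & G a b c]).

Definition div_mid (gamma delta n : R) : \bar R :=
  sup_div gamma delta (fun a b c : X =>
    [/\ mdist a b <= n, G a b c & mdist c a = mdist c b]).

End Divergence.

(* Functions of a real variable n >= 0 with values in [0, +oo]. *)
Definition fun_le (f g : R -> \bar R) : Prop :=
  exists2 K : R, 1 < K &
    forall n, 0 <= n -> (f n <= K%:E * g (K * n)%R + (K * n)%:E + K%:E)%E.

Definition fun_equiv (f g : R -> \bar R) : Prop := fun_le f g /\ fun_le g f.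

End MetricSpaces.

(* Main.v *)
Require Import Defs.
From HB Require Import structures.
From mathcomp Require Import all_boot all_order all_algebra.
From mathcomp Require Import all_classical all_reals all_analysis.
From mathcomp Require Import ring lra.

(** All the functions lie between the midpoint divergence and [Div], so it is
    enough to bound [Div], with parameters [gamma1], [delta1], by the midpoint
    divergence with parameters [gamma2], [delta2]. Let [d(a, b) <= n] and
    [r = d(c, {a, b})]. If [n <= r] or [n <= 4 kappa], a geodesic from [a] to
    [b] avoids the ball [B(c, delta1 r - gamma1)]. Otherwise one of the two rays
    of a bi-Lipschitz line through a point close to [a] avoids this ball
    ([delta1 <= 1 / (C ^ 2 + 1)] is what this takes), and it leads to a point
    [a'] at distance at least [D] from [c], where [D] is a large multiple of
    [n]; let [b'] be obtained from [b] in the same way. If a geodesic [[a', b']]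
    meets [B(c, n)] at [c'], cut out its longest subsegment with midpoint [c']:
    a path joining the ends of that subsegment far from [c'] avoids [B(c, n)],
    as do the remaining two pieces of [[a', b']]. Since [kappa < n], the additive
    constants are absorbed into multiples of [n]. *)

Set Implicit Arguments.
Unset Strict Implicit.
Unset Printing Implicit Defensive.

Import Order.TTheory GRing.Theory Num.Theory.
Import numFieldNormedType.Exports.

Local Open Scope classical_set_scope.
Local Open Scope ring_scope.

(** * Lengths of paths, and concatenation of paths that avoid a set *)

Section Paths.
Context {R : realType} {X : metricType R}.
Implicit Types (p q : R -> X) (a b c : X) (B : set X) (s : seq R).

(** The sum inside [path_length], made recursive so that inductions on the partition need neither
    indices nor the default value of [nth]. *)
Fixpoint chain_length p (u : R) s : R :=
  if s is v :: s' then mdist (p u) (p v) + chain_length p v s' else 0.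

Lemma chain_lengthE p (u v : R) s :
  \sum_(0 <= i < size s)
    mdist (p (nth v (u :: s) i)) (p (nth v (u :: s) i.+1)) =
  chain_length p u s.
Proof.
elim: s u => [|w s IH] u /=; first by rewrite big_nil.
by rewrite big_nat_recl// -IH.
Qed.

Lemma path_length_leP p (u v L : R) :
  (path_length u v p <= L%:E)%E <->
  forall s, itv_partition u v s -> chain_length p u s <= L.
Proof.
split=> [pL s uvs|pL].
  rewrite -lee_fin -(chain_lengthE p u v); apply: le_trans pL.
  by apply: ereal_sup_ubound; exists s.
by apply: ge_ereal_sup => _ [s uvs <-]; rewrite lee_fin chain_lengthE pL.
Qed.

Lemma chain_length_map p (h : R -> R) (u : R) s :
  chain_length (p \o h) u s = chain_length p (h u) (map h s).
Proof. by elim: s u => //= v s IH u; rewrite IH. Qed.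

Lemma itv_partition_map (h : R -> R) (u v : R) s :
  {mono h : x y / x < y} -> itv_partition u v s ->
  itv_partition (h u) (h v) (map h s).
Proof.
move=> hlt [us /eqP us_v]; split; last by rewrite last_map us_v.
by rewrite (mono_path hlt).
Qed.

Lemma eq_in_chain_length p q (u v : R) s :
  {in `[u, v], p =1 q} -> itv_partition u v s ->
  chain_length p u s = chain_length q u s.
Proof.
elim: s u => //= x s IH u pq [/andP[ux xs] sv].
have xv : x <= v by apply: (@itv_partition_le _ _ x v s).
rewrite (pq u) ?(pq x) ?in_itv/= ?lexx ?xv ?(ltW ux)// ?(le_trans (ltW ux))//.
congr (_ + _); apply: IH => // t; rewrite in_itv/= => /andP[xt tv].
by rewrite pq// in_itv/= tv (le_trans (ltW ux)).
Qed.

(** By the triangle inequality, inserting [w] does not shorten a chain. This is why the length of a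
    concatenation is at most the sum of the lengths. *)
Lemma chain_length_split p (u v w : R) s : u <= w <= v -> itv_partition u v s ->
  exists s1 s2, [/\ itv_partition u w s1, itv_partition w v s2
    & chain_length p u s <= chain_length p u s1 + chain_length p w s2].
Proof.
elim: s u => [|x s IH] u /=.
  move=> /andP[uw wv] [_ /= /eqP uv]; have -> : w = u by move: uw wv uv; lra.
  by exists [::], [::]; split; rewrite ?addr0//; split=> //; apply/eqP.
move=> /andP[uw wv] [/andP[ux xs] sv].
have [xw|wx] := leP x w.
  have [|//|s1 [s2 [[s1p s1l] s2p le12]]] := IH x; first by rewrite xw.
  exists (x :: s1), s2; split=> //; first by split=> //=; rewrite ux.
  by rewrite /= -addrA lerD2l.
(* Partitions increase strictly, so nothing may be inserted when [w = u]. *)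
have [<-|uw'] := eqVneq u w.
  exists [::], (x :: s); split => //=; last by rewrite add0r.
  by split=> //=; rewrite ux.
exists [:: w], (x :: s); split=> //.
- by split=> //=; rewrite lt_neqAle uw' uw.
- by split=> //=; rewrite wx.
- by rewrite /= addr0 addrA lerD2r metric_triangle.
Qed.

Lemma chain_length_lipschitz p (k u v : R) s : 0 <= k ->
  {in `[u, v] &, forall x y, mdist (p x) (p y) <= k * `|x - y|} ->
  itv_partition u v s -> chain_length p u s <= k * (v - u).
Proof.
move=> k0; elim: s u => [|x s IH] u plip /=.
  by move=> [_ /= /eqP ->]; rewrite subrr mulr0.
move=> [/andP[ux xs] sv].
have xv : x <= v by apply: (@itv_partition_le _ _ x v s).
have uxlip : mdist (p u) (p x) <= k * (x - u).
  rewrite -(gtr0_norm (x := x - u)) ?subr_gt0// distrC.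
  by apply: plip; rewrite in_itv/= ?lexx ?xv ?(ltW ux)// (le_trans (ltW ux)).
have -> : k * (v - u) = k * (x - u) + k * (v - x) by ring.
apply: lerD => //; apply: IH => // y z; rewrite !in_itv/= => /andP[xy yv] /andP[xz zv].
by apply: plip; rewrite in_itv/= ?yv ?zv (le_trans (ltW ux)).
Qed.

Lemma within_continuous_mdistP p (A : set R) :
  {within A, continuous p} <->
  forall x, A x -> forall e, 0 < e -> exists2 d, 0 < d &
    forall y, A y -> `|x - y| < d -> mdist (p x) (p y) < e.
Proof.
rewrite subspace_continuousP; split=> pc x Ax.
  move=> e e0; have /metricType_numDomainType.cvgrPdist_lt/(_ e e0) := pc x Ax.
  rewrite /within/= => -[d /= d0 dP]; exists d => // y Ay xy; exact: dP.
apply/metricType_numDomainType.cvgrPdist_lt => e e0.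
have [d d0 dP] := pc x Ax e e0.
exists d => //= y xy Ay; exact: dP.
Qed.

(** A bound on [div_at] witnessed by an actual path, the form that can be concatenated. *)
Definition joined B (L : R) a b : Prop :=
  exists2 p, path_avoiding B a b p & (path_length 0 1 p <= L%:E)%E.

Lemma joined_le B L L' a b : L <= L' -> joined B L a b -> joined B L' a b.
Proof.
by move=> LL' [p pab pL]; exists p => //; apply: le_trans pL _; rewrite lee_fin.
Qed.

Lemma joined_subset B B' L a b : B `<=` B' -> joined B' L a b -> joined B L a b.
Proof.
move=> BB' [p [pc p0 p1 pB'] pL]; exists p => //; split=> // t t01.
by move/BB'; apply: pB'.
Qed.

(** Reparametrized affinely over [[0, 1]], the path has Lipschitz constant [k * |v - u|], which
    gives both continuity and length. Since [v < u] is allowed, [f] can also be run backwards. *)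
Lemma joined_lipschitz B (f : R -> X) (k u v : R) : 0 <= k ->
  (forall x y, Num.min u v <= x <= Num.max u v ->
     Num.min u v <= y <= Num.max u v -> mdist (f x) (f y) <= k * `|x - y|) ->
  (forall x, Num.min u v <= x <= Num.max u v -> ~ B (f x)) ->
  joined B (k * `|v - u|) (f u) (f v).
Proof.
move=> k0 flip fB; pose h t := u + t * (v - u).
have hI t : t \in `[0, 1] -> Num.min u v <= h t <= Num.max u v.
  rewrite in_itv/= /h => /andP[t0 t1].
  by have [uv|uv] := leP u v; apply/andP; split; nra.
have hlip : {in `[0, 1] &, forall x y,
    mdist ((f \o h) x) ((f \o h) y) <= (k * `|v - u|) * `|x - y|}.
  move=> x y x01 y01; apply: le_trans (flip _ _ (hI x x01) (hI y y01)) _.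
  have -> : h x - h y = (v - u) * (x - y) by rewrite /h; ring.
  by rewrite normrM mulrA.
have kuv : 0 <= k * `|v - u| by rewrite mulr_ge0.
exists (f \o h).
  split; rewrite /= /h ?mul0r ?addr0// ?mul1r ?subrKC//.
  - apply/within_continuous_mdistP => x x01 e e0.
    (* The added 1 keeps the denominator positive when the Lipschitz constant is 0. *)
    exists (e / (k * `|v - u| + 1)); first by rewrite divr_gt0// ltr_wpDl.
    move=> y y01; rewrite ltr_pdivlMr ?ltr_wpDl// => xy.
    apply: le_lt_trans (hlip x y x01 y01) _; apply: le_lt_trans xy.
    by rewrite mulrC ler_wpM2l// lerDl.
  - by move=> t t01; apply: fB; apply: hI.
apply/path_length_leP => s s01.
have := chain_length_lipschitz kuv hlip s01.
by rewrite subr0 mulr1.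
Qed.

Lemma joined_trans B L1 L2 a b c :
  joined B L1 a b -> joined B L2 b c -> joined B (L1 + L2) a c.
Proof.
move=> [p [pc p0 p1 pB] pL] [q [qc q0 q1 qB] qL].
pose r t := if t <= 2^-1 then p (2 * t) else q (2 * t - 1).
(* At 1/2 the definition of [r] takes the branch [p], but the branches agree there, as
   [p 1 = b = q 0]. *)
have rE : {in `[2^-1, 1], r =1 q \o (fun t => 2 * t - 1)}.
  move=> t; rewrite in_itv/= /r => /andP[t2 _].
  case: ifPn => // t2'; have -> : t = 2^-1 by move: t2 t2'; lra.
  by rewrite /= mulfV ?pnatr_eq0// subrr p1 q0.
exists r.
  split.
  - have -> : `[0, 1]%classic = `[0, 2^-1]%classic `|` `[2^-1, 1]%classic :> set R.
      apply/seteqP; split=> x /=; rewrite !in_itv/=.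
        by move=> /andP[x0 x1]; have [x2|x2] := leP x 2^-1; [left|right];
          rewrite ?x0 ?x1 ?(ltW x2).
      by case=> /andP[? ?]; apply/andP; split; lra.
    apply: withinU_continuous; try exact: interval_closed.
      apply/within_continuous_mdistP => x /=; rewrite in_itv/= => /andP[x0 x2] e e0.
      have x01 : `[0, 1]%classic (2 * x) by rewrite /= in_itv/=; apply/andP; split; lra.
      have [d d0 dP] := (within_continuous_mdistP _ _).1 pc _ x01 e e0.
      exists (d / 2); first by rewrite divr_gt0.
      move=> y; rewrite in_itv/= => /andP[y0 y2] xy; rewrite /r x2 y2.
      apply: dP; first by rewrite /= in_itv/=; apply/andP; split; lra.
      by rewrite -mulrBr normrM ger0_norm// mulrC -ltr_pdivlMr.
    apply/within_continuous_mdistP => x xI e e0.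
    have := xI; rewrite /= in_itv/= => /andP[x0 x2].
    have x01 : `[0, 1]%classic (2 * x - 1) by rewrite /= in_itv/=; apply/andP; split; lra.
    have [d d0 dP] := (within_continuous_mdistP _ _).1 qc _ x01 e e0.
    exists (d / 2); first by rewrite divr_gt0.
    move=> y yI xy; rewrite !rE//=.
    have := yI; rewrite /= in_itv/= => /andP[y0 y2].
    apply: dP; first by rewrite /= in_itv/=; apply/andP; split; lra.
    have -> : 2 * x - 1 - (2 * y - 1) = 2 * (x - y) by ring.
    by rewrite normrM ger0_norm// mulrC -ltr_pdivlMr.
  - by rewrite /r invr_ge0 ler0n mulr0 p0.
  - rewrite rE ?in_itv/= ?lexx ?andbT; last by lra.
    by rewrite mulr1 -q1; congr q; lra.
  - move=> t; rewrite in_itv/= => /andP[t0 t1]; rewrite /r.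
    case: (leP t 2^-1) => t2; [apply: pB|apply: qB];
    by rewrite in_itv/=; apply/andP; split; lra.
move/path_length_leP: pL => pL; move/path_length_leP: qL => qL.
apply/path_length_leP => s s01.
(* Cut the partition at 1/2 and rescale its halves to partitions of [[0, 1]] for [p] and [q]. *)
have [|s1 [s2 [s1P s2P le12]]] := @chain_length_split r 0 1 2^-1 s _ s01.
  by apply/andP; split; lra.
apply: le_trans le12 _; apply: lerD.
  rewrite (@eq_in_chain_length r (p \o *%R 2) 0 2^-1)//; last first.
    by move=> t; rewrite in_itv/= /r => /andP[_ ->].
  rewrite chain_length_map mulr0; apply: pL.
  have := @itv_partition_map ( *%R 2) _ _ _ _ s1P.
  rewrite mulr0 mulfV ?pnatr_eq0//; apply=> x y.
  by rewrite ltr_pM2l.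
rewrite (eq_in_chain_length rE s2P) chain_length_map mulfV ?pnatr_eq0// subrr.
apply: qL.
have := @itv_partition_map (fun t => 2 * t - 1) _ _ _ _ s2P.
rewrite mulfV ?pnatr_eq0// subrr mulr1.
have -> : 2 - 1 = 1 :> R by lra.
apply=> x y; by rewrite ltrD2r ltr_pM2l.
Qed.

End Paths.

(** * Geodesics, bi-Lipschitz rays and paths around a ball *)

Section Divergence.
Context {R : realType} {X : metricType R}.
Implicit Types (a b c : X) (B : set X).

Definition geodesic_param a b (f : R -> X) : Prop :=
  [/\ f 0 = a, f (mdist a b) = b
    & {in `[0, mdist a b] &, forall s t, mdist (f s) (f t) = `|s - t|}].

Lemma notin_ball c (rho : R) (x : X) : rho <= mdist c x -> ~ ball c rho x.
Proof. by rewrite ballEmdist/= ltNge => ->. Qed.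

Lemma joined_geodesic B a b (f : R -> X) (u v : R) : geodesic_param a b f ->
  0 <= u <= mdist a b -> 0 <= v <= mdist a b ->
  (forall x, Num.min u v <= x <= Num.max u v -> ~ B (f x)) ->
  joined B `|v - u| (f u) (f v).
Proof.
move=> [_ _ fiso] /andP[u0 u1] /andP[v0 v1] fB; rewrite -[`|_|]mul1r.
have inI x : Num.min u v <= x <= Num.max u v -> x \in `[0, mdist a b].
  by rewrite in_itv/=; case: (leP u v) => _ /andP[? ?]; apply/andP; split; lra.
by apply: joined_lipschitz => // x y /inI x01 /inI y01; rewrite fiso ?mul1r.
Qed.

Lemma geodesic_mdist a b (f : R -> X) (u v : R) : geodesic_param a b f ->
  0 <= u <= mdist a b -> 0 <= v <= mdist a b ->
  mdist (f u) (f v) = `|u - v|.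
Proof. by move=> [_ _ fiso] u01 v01; rewrite fiso ?in_itv. Qed.

Lemma geodesic_space_param a b : geodesic_space X ->
  exists f, geodesic_param a b f.
Proof. by move=> /(_ a b)[_ [f [f0 f1 fiso _]]]; exists f. Qed.

Lemma bilipschitz_line_isometry (C : R) (p : R -> X) (g : X -> X) :
  is_isometry g -> bilipschitz_line C p -> bilipschitz_line C (g \o p).
Proof. by move=> [_ giso] pC s t; rewrite /= giso. Qed.

(* If both rays of the line met the ball, at parameters [s] and [- u], then
   [s, u > C * rho] by the upper bound and [s + u < 2 * C * rho] by the lower
   one. *)
Lemma bilipschitz_ray_avoids (C rho t0 : R) (q : R -> X) c : 1 <= C ->
  bilipschitz_line C q -> rho * (C ^+ 2 + 1) <= mdist c (q t0) ->
  exists2 e : R, `|e| = 1 & forall s, 0 <= s -> rho <= mdist c (q (t0 + e * s)).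
Proof.
move=> C1 qC far; have C0 : 0 < C by lra.
have qU s t : mdist (q s) (q t) <= C * `|s - t| by have /andP[] := qC s t.
have qL s t : `|s - t| <= C * mdist (q s) (q t).
  by have /andP[+ _] := qC s t; rewrite mulrC ler_pdivrMr// [_ * C]mulrC.
have [pos|] := pselect (forall s, 0 <= s -> rho <= mdist c (q (t0 + s))).
  by exists 1; rewrite ?normr1// => s s0; rewrite mul1r pos.
move=> /existsNP[s /not_implyP[s0 /negP]]; rewrite -ltNge => sB.
exists (-1) => [|u u0]; first by rewrite normrN1.
rewrite mulN1r leNgt; apply/negP => uB.
have := qU t0 (t0 + s); rewrite opprD addNKr normrN ger0_norm// => Us.
have := qU t0 (t0 - u); rewrite subKr ger0_norm// => Uu.
have := qL (t0 + s) (t0 - u).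
have -> : t0 + s - (t0 - u) = s + u by ring.
rewrite ger0_norm ?addr_ge0// => Lsu.
have := metric_triangle (q (t0 + s)) c (q (t0 - u)).
rewrite (metric_sym (q (t0 + s)) c) => tri.
have := metric_triangle c (q (t0 + s)) (q t0).
rewrite (metric_sym (q (t0 + s))) => tris.
have := metric_triangle c (q (t0 - u)) (q t0).
rewrite (metric_sym (q (t0 - u))) => triu.
(* Here [rho * (C ^+ 2 + 1) < rho + C * s]: the summand 1 pays for the radius of the ball. *)
have Cs : C * (rho * C) < C * s by move: far; rewrite expr2; lra.
have Cu : C * (rho * C) < C * u by move: far; rewrite expr2; lra.
rewrite !ltr_pM2l// in Cs Cu.
have : C * mdist (q (t0 + s)) (q (t0 - u)) < C * (2 * rho) by rewrite ltr_pM2l//; lra.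
lra.
Qed.

(** Follow a geodesic from [a] to [q t0], then the ray that avoids the ball. Both orientations are
    recorded, because the final path leaves one end outwards and reaches the other one inwards. *)
Lemma escape (C kappa rho t0 D : R) (q : R -> X) a c : geodesic_space X ->
  1 <= C -> bilipschitz_line C q -> mdist a (q t0) < kappa -> 0 <= D ->
  rho * (C ^+ 2 + 1) + kappa <= mdist c a ->
  let L := kappa + C ^+ 2 * (D + mdist c a + kappa) in
  exists a', [/\ D <= mdist c a', mdist a a' <= L,
    joined (ball c rho) L a a' & joined (ball c rho) L a' a].
Proof.
move=> Xgeo C1 qC aq D0 far L; have C0 : 0 < C by lra.
have tri1 := metric_triangle c (q t0) a; rewrite (metric_sym (q t0)) in tri1.
have tri2 := metric_triangle c a (q t0).
have [|e e1 eB] := @bilipschitz_ray_avoids C rho t0 q c C1 qC; first by lra.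
have ca := mdist_ge0 c a.
(* At parameter [S] the ray is at distance at least [S / C] from [q t0], hence at least [D] from
   [c]. *)
pose S := C * (D + mdist c a + kappa).
have k0 : 0 < kappa by apply: le_lt_trans aq; apply: mdist_ge0.
have S0 : 0 <= S by rewrite mulr_ge0//; lra.
have qU s t : mdist (q s) (q t) <= C * `|s - t| by have /andP[] := qC s t.
have eS x : `|t0 + e * x - t0| = `|x| by rewrite addrC addKr normrM e1 mul1r.
have CS : C * S = C ^+ 2 * (D + mdist c a + kappa) by rewrite /S; ring.
have [f fP] := geodesic_space_param a (q t0) Xgeo.
have fB x : 0 <= x <= mdist a (q t0) -> ~ ball c rho (f x).
  move=> /andP[x0 x1]; apply: notin_ball.
  (* For [rho <= 0] the ball is empty; otherwise the margin [kappa] in the hypothesis covers the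
     distance from [a]. *)
  have [r0|r0] := leP rho 0; first by apply: le_trans r0 _; apply: mdist_ge0.
  have := geodesic_mdist fP (u := 0) (v := x); rewrite lexx x0 x1 mdist_ge0.
  have [-> _ _] := fP => /(_ isT isT); rewrite sub0r normrN ger0_norm// => fx.
  have := metric_triangle c (f x) a; rewrite (metric_sym (f x)) fx.
  have : 0 <= rho * C ^+ 2 by rewrite mulr_ge0 ?(ltW r0) ?sqr_ge0.
  lra.
have d0 := mdist_ge0 a (q t0).
have [f0 f1 _] := fP.
have j1 : joined (ball c rho) (mdist a (q t0)) a (q t0).
  have := @joined_geodesic (ball c rho) _ _ _ 0 (mdist a (q t0)) fP.
  rewrite f0 f1 subr0 ger0_norm//; apply; rewrite ?lexx ?d0//.
  by move=> x; rewrite min_l// max_r//; apply: fB.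
have j2 : joined (ball c rho) (mdist a (q t0)) (q t0) a.
  have := @joined_geodesic (ball c rho) _ _ _ (mdist a (q t0)) 0 fP.
  rewrite f0 f1 sub0r normrN ger0_norm//; apply; rewrite ?lexx ?d0//.
  by move=> x; rewrite min_r// max_l//; apply: fB.
pose h x := q (t0 + e * x).
have h0 : h 0 = q t0 by rewrite /h mulr0 addr0.
have hU x y : mdist (h x) (h y) <= C * `|x - y|.
  apply: le_trans (qU _ _) _.
  have -> : t0 + e * x - (t0 + e * y) = e * (x - y) by ring.
  by rewrite normrM e1 mul1r.
exists (h S); split.
- have := qC t0 (t0 + e * S); rewrite distrC eS (ger0_norm S0) => /andP[+ _].
  rewrite /S mulKf ?gt_eqF// -/S -/(h S) => lo.
  have := metric_triangle (q t0) c (h S); rewrite (metric_sym _ c).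
  lra.
- have := metric_triangle a (q t0) (h S).
  have := hU 0 S; rewrite h0 sub0r normrN ger0_norm// CS /L; lra.
- apply: joined_le (joined_trans j1 _); last first.
    rewrite -h0; apply: (@joined_lipschitz _ _ _ h C) => //; first by lra.
    move=> x; rewrite min_l// => /andP[x0 _]; exact/notin_ball/eB.
  by rewrite subr0 ger0_norm// CS /L; lra.
- apply: joined_le (joined_trans _ j2); last first.
    rewrite -h0; apply: (@joined_lipschitz _ _ _ h C) => //; first by lra.
    move=> x; rewrite min_r// => /andP[x0 _]; exact/notin_ball/eB.
  by rewrite sub0r normrN ger0_norm// CS /L; lra.
Qed.

Lemma div_at_le (gamma delta L : R) a b c :
  joined (ball c (delta * dist_pair c a b - gamma)) L a b ->
  (div_at gamma delta a b c <= L%:E)%E.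
Proof. by move=> [p pab pL]; apply: ge_ereal_inf; exists (path_length 0 1 p) => //; exists p. Qed.

(** The infimum need not be attained, whence the slack; it becomes the [+ 1] in [detour]. *)
Lemma div_at_joined (gamma delta L L' : R) a b c : L < L' ->
  (div_at gamma delta a b c <= L%:E)%E ->
  joined (ball c (delta * dist_pair c a b - gamma)) L' a b.
Proof.
move=> LL' abL; have : (div_at gamma delta a b c < L'%:E)%E.
  by apply: le_lt_trans abL _; rewrite lte_fin.
by move=> /ereal_inf_lt[_ [p pab <-] /ltW pL]; exists p.
Qed.

Lemma sup_div_ge0 (gamma delta : R) (P : X -> X -> X -> Prop) :
  (0 <= sup_div gamma delta P)%E.
Proof. by apply: ereal_sup_ubound; left. Qed.

Lemma sup_div_ubound (gamma delta : R) (P : X -> X -> X -> Prop) a b c :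
  0 < dist_pair c a b -> P a b c ->
  (div_at gamma delta a b c <= sup_div gamma delta P)%E.
Proof. by move=> cab abc; apply: ereal_sup_ubound; right; exists a, b, c. Qed.

Lemma sup_div_le (gamma delta : R) (P : X -> X -> X -> Prop) (M : \bar R) :
  (0 <= M)%E ->
  (forall a b c, 0 < dist_pair c a b -> P a b c ->
     (div_at gamma delta a b c <= M)%E) ->
  (sup_div gamma delta P <= M)%E.
Proof.
move=> M0 PM; apply: ge_ereal_sup => _ [->//|[a [b [c [cab abc ->]]]]].
exact: PM.
Qed.

Lemma subset_sup_div (gamma delta : R) (P Q : X -> X -> X -> Prop) :
  (forall a b c, P a b c -> Q a b c) ->
  (sup_div gamma delta P <= sup_div gamma delta Q)%E.
Proof.
move=> PQ; apply: sup_div_le; first exact: sup_div_ge0.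
by move=> a b c cab abc; apply: sup_div_ubound => //; apply: PQ.
Qed.

(** Each point of a geodesic is within half its length of one of the ends. *)
Lemma geodesic_far a b c (f : R -> X) (x : R) : geodesic_param a b f ->
  0 <= x <= mdist a b -> dist_pair c a b - mdist a b / 2 <= mdist c (f x).
Proof.
move=> fP x01; have [f0 f1 _] := fP; have d0 := mdist_ge0 a b.
have := geodesic_mdist fP _ x01 (u := 0); rewrite lexx d0 => /(_ isT).
have := geodesic_mdist fP _ x01 (u := mdist a b); rewrite lexx d0 => /(_ isT).
case/andP: x01 => x0 x1; rewrite f0 f1 sub0r normrN !ger0_norm ?subr_ge0// => fb fa.
have := metric_triangle c (f x) a; rewrite (metric_sym (f x)) fa => ca.
have := metric_triangle c (f x) b; rewrite (metric_sym (f x)) fb => cb.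
have : dist_pair c a b <= mdist c a by rewrite /dist_pair ge_min lexx.
have : dist_pair c a b <= mdist c b by rewrite /dist_pair ge_min lexx orbT.
lra.
Qed.

(** If [f u] lies in [B(c, n)], both ends are at distance at least [D - n] from it. The ball removed
    around [f u] then has radius at least [2 * n] and contains [B(c, n)], while [3 * n <= D] keeps
    the outer pieces off [B(c, n)]. *)
Lemma detour (gamma delta n D v : R) a b c (f : R -> X) :
  geodesic_param a b f -> 0 < n -> 3 * n <= D -> 0 < delta ->
  2 * n <= delta * (D - n) - gamma -> D <= mdist c a -> D <= mdist c b ->
  0 <= v ->
  (forall s u t, 0 <= s -> s < u -> u < t -> t <= mdist a b ->
     u - s = t - u -> (div_at gamma delta (f s) (f t) (f u) <= v%:E)%E) ->
  joined (ball c n) (mdist a b + v + 1) a b.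
Proof.
move=> fP n0 nD delta0 big ca cb v0 fdiv; have [f0 f1 _] := fP.
have d0 := mdist_ge0 a b; set d := mdist a b in d0 fdiv *.
have fd x y : 0 <= x <= d -> 0 <= y <= d -> mdist (f x) (f y) = `|x - y|.
  exact: geodesic_mdist fP.
have [far|] := pselect (forall u, 0 <= u <= d -> n <= mdist c (f u)).
  apply: (@joined_le _ _ _ d); first by rewrite -addrA lerDl addr_ge0.
  have := @joined_geodesic (ball c n) _ _ _ 0 d fP.
  rewrite f0 f1 subr0 ger0_norm//; apply; rewrite ?lexx ?d0//.
  by move=> x; rewrite min_l// max_r// => /far; apply: notin_ball.
move=> /existsNP[u /not_implyP[/andP[u0 ud] /negP]]; rewrite -ltNge => cu.
have au : mdist a (f u) = u.
  by rewrite -f0 fd ?lexx ?d0 ?u0// sub0r normrN ger0_norm.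
have ub : mdist (f u) b = d - u.
  by rewrite -f1 fd ?lexx ?d0 ?u0// distrC ger0_norm// subr_ge0.
have := metric_triangle c (f u) a; rewrite (metric_sym (f u)) au => tria.
have := metric_triangle c (f u) b; rewrite ub => trib.
(* The largest radius for which [f (u - h)] and [f (u + h)] both lie on the geodesic. *)
pose h := Num.min u (d - u).
have hu : h <= u by rewrite /h ge_min lexx.
have hd : h <= d - u by rewrite /h ge_min lexx orbT.
have hD : D - n <= h by rewrite /h le_min; apply/andP; split; lra.
have bit x : 0 <= x <= d -> h <= `|x - u| -> ~ ball c n (f x).
  move=> xd hx; apply: notin_ball; rewrite -fd ?u0// in hx.
  by have := metric_triangle (f x) c (f u); rewrite (metric_sym (f x) c); lra.
have sm : 0 <= u - h <= d by apply/andP; split; lra.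
have tm : 0 <= u + h <= d by apply/andP; split; lra.
have j1 : joined (ball c n) (u - h) a (f (u - h)).
  have [s0 sd] := andP sm.
  have := @joined_geodesic (ball c n) _ _ _ 0 (u - h) fP.
  rewrite f0 subr0 ger0_norm//; apply; rewrite ?lexx ?d0// => x.
  rewrite min_l// max_r// => /andP[x0 xs]; apply: bit.
    by apply/andP; split; lra.
  by rewrite distrC ger0_norm; lra.
have j3 : joined (ball c n) (d - (u + h)) (f (u + h)) b.
  have [t0 td] := andP tm.
  have := @joined_geodesic (ball c n) _ _ _ (u + h) d fP.
  rewrite f1 ger0_norm ?subr_ge0//; apply; rewrite ?lexx ?d0// => x.
  rewrite min_l// max_r// => /andP[x0 xs]; apply: bit.
    by apply/andP; split; lra.
  by rewrite ger0_norm; lra.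
have j2 : joined (ball c n) (v + 1) (f (u - h)) (f (u + h)).
  have [s0 sd] := andP sm; have [t0 td] := andP tm.
  have vv1 : v < v + 1 by lra.
  have : (div_at gamma delta (f (u - h)%R) (f (u + h)%R) (f u) <= v%:E)%E.
    by apply: fdiv; lra.
  move=> /(div_at_joined vv1); apply: joined_subset.
  have -> : dist_pair (f u) (f (u - h)) (f (u + h)) = h.
    rewrite /dist_pair !fd ?u0// subKr opprD addNKr normrN minxx ger0_norm//; lra.
  move=> y; rewrite !ballEmdist/= => cy.
  have := metric_triangle (f u) c y; rewrite (metric_sym (f u) c) => uy.
  have : delta * (D - n) <= delta * h by rewrite ler_pM2l.
  lra.
apply: joined_le (joined_trans (joined_trans j1 j2) j3); lra.
Qed.

(* [Q a b c] is the condition put on the triples of the smaller divergence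
   function; it has to hold when [c] is the midpoint of a subsegment [a, b] of
   a suitable geodesic. *)
Lemma Div_fun_le (kappa C gamma1 gamma2 delta1 delta2 : R)
    (Q : X -> X -> X -> Prop) :
  geodesic_space X -> 0 < kappa -> 1 <= C ->
  (forall x : X, exists (q : R -> X) (t : R),
     bilipschitz_line C q /\ mdist x (q t) < kappa) ->
  4 * kappa <= gamma1 -> 0 <= gamma2 ->
  0 < delta1 <= 1 / (C ^+ 2 + 1) -> 0 < delta2 <= 1 ->
  (forall a b, exists2 f, geodesic_param a b f &
     forall s u t, 0 <= s -> s < u -> u < t -> t <= mdist a b ->
       u - s = t - u -> Q (f s) (f t) (f u)) ->
  fun_le (Div X gamma1 delta1)
    (fun n => sup_div gamma2 delta2 (fun a b c => mdist a b <= n /\ Q a b c)).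
Proof.
move=> Xgeo k0 C1 near g1 g2 /andP[d1 d1C] /andP[d2 d2_1] QP.
have E1 : 1 <= C ^+ 2 by rewrite exprn_ege1.
move: d1C; rewrite ler_pdivlMr; last lra; move=> d1C.
set E := C ^+ 2 in E1 d1C.
have d1_half : delta1 * 2 <= 1 by nra.
(* With [D = n * (1 + e)] one gets [delta2 * (D - n) = (2 + g) * n], at least [2 * n + gamma2] when
   [kappa < n]. The factor [l] comes from the length in [escape]:
   [kappa + E * (D + 2 * n + kappa) <= l * n]. *)
pose g := gamma2 / kappa; pose e := (2 + g) / delta2; pose l := 1 + E * (e + 4).
have g0 : 0 <= g by rewrite divr_ge0// ltW.
have gk : gamma2 = g * kappa by rewrite /g divfK// gt_eqF.
have de : delta2 * e = 2 + g by rewrite /e mulrCA mulfV ?mulr1// gt_eqF.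
have e2 : 2 <= e by nra.
have l0 : 1 <= l by rewrite /l lerDl mulr_ge0//; lra.
(* Ample for the final path, of length at most [(4 * l + 1) * n + v + 1], and for the geodesic from
   [a'] to [b'], of length at most [(2 * l + 1) * n]. *)
exists (6 * l + 3); first lra.
move=> n n0; set V := sup_div _ _ _.
have V0 : (0 <= V)%E by exact: sup_div_ge0.
have K0 : 0 < 6 * l + 3 by lra.
have Kn0 : 0 <= (6 * l + 3) * n by rewrite mulr_ge0//; lra.
apply: sup_div_le.
  by rewrite !adde_ge0// ?mule_ge0// lee_fin// ltW.
move=> a b c r0 abn; set r := dist_pair c a b in r0.
have abd := mdist_ge0 a b.
have [f fP Qf] := QP a b.
(* The geodesic stays at distance at least [r - n / 2] from [c], and
   [delta1 * r - gamma1 <= r / 2 - gamma1]. Use [gamma1 >= 0] if [n <= r], and [gamma1 >= n] if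
   [n <= 4 * kappa]. *)
have case_near : n <= r \/ n <= 4 * kappa ->
    joined (ball c (delta1 * r - gamma1)) (mdist a b) a b.
  move=> cases; have [f0 f1 _] := fP.
  have := @joined_geodesic (ball c (delta1 * r - gamma1)) _ _ _ 0 (mdist a b) fP.
  rewrite f0 f1 subr0 ger0_norm//; apply; rewrite ?lexx ?abd//.
  move=> x; rewrite min_l// max_r// => xd; apply: notin_ball.
  have := geodesic_far c fP xd; have := mdist_ge0 c (f x); rewrite -/r.
  by case: cases; nra.
have add_V (x y : R) : x <= y -> (x%:E <= (6 * l + 3)%:E * V + y%:E)%E.
  move=> xy; rewrite -[x%:E]add0e; apply: leeD; last by rewrite lee_fin.
  by rewrite mule_ge0// lee_fin ltW.
have [/case_near/div_at_le nearle|] := pselect (n <= r \/ n <= 4 * kappa).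
  apply: le_trans nearle _; rewrite -addeA; apply: add_V; nra.
move=> /not_orP[/negP + /negP]; rewrite -!ltNge => rn kn {case_near add_V f fP Qf}.
have cab : mdist c a <= 2 * n /\ mdist c b <= 2 * n.
  have := metric_triangle c a b; have := metric_triangle c b a.
  rewrite (metric_sym b a); move: rn; rewrite /r /dist_pair.
  by case: (leP (mdist c a) (mdist c b)) => _ ? ? ?; split; lra.
pose D := n * (1 + e).
have D0 : 3 * n <= D by rewrite /D; nra.
have escape_n x : mdist c x <= 2 * n -> r <= mdist c x ->
    exists x', [/\ D <= mdist c x', mdist x x' <= l * n,
      joined (ball c (delta1 * r - gamma1)) (l * n) x x' &
      joined (ball c (delta1 * r - gamma1)) (l * n) x' x].
  move=> cx rx; have [q [t [qC qx]]] := near x.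
  have [||x' [Dx' xx' j1 j2]] :=
    @escape C kappa (delta1 * r - gamma1) t D q x c Xgeo C1 qC qx; first lra.
    (* Here the thresholds enter: [delta1 * (E + 1) <= 1] bounds the left side by
       [r - gamma1 * (E + 1) + kappa], and [gamma1 >= 4 * kappa] absorbs [kappa]. *)
    rewrite -/E; nra.
  have Ll : kappa + C ^+ 2 * (D + mdist c x + kappa) <= l * n.
    rewrite -/E /l mulrDl mul1r; apply: lerD; first lra.
    by rewrite -mulrA ler_wpM2l//; rewrite /D; lra.
  exists x'; split=> //; [exact: le_trans xx' _|exact: joined_le j1|exact: joined_le j2].
have [a' [Da' aa' ja _]] := escape_n a cab.1 (ltac:(by rewrite /r /dist_pair ge_min lexx)).
have [b' [Db' bb' _ jb]] := escape_n b cab.2 (ltac:(by rewrite /r /dist_pair ge_min lexx orbT)).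
have ab' : mdist a' b' <= (2 * l + 1) * n.
  have := metric_triangle a' a b'; have := metric_triangle a b b'.
  rewrite (metric_sym a' a); lra.
have [f fP Qf] := QP a' b'; have [f0 f1 _] := fP.
(* An infinite supremum makes the bound trivial. *)
case V_eq : V V0 => [v| |] // v0; last first.
  by rewrite gt0_muley ?lte_fin// addye ?addye// ?leey.
rewrite lee_fin in v0.
have jm : joined (ball c n) (mdist a' b' + v + 1) a' b'.
  apply: (@detour gamma2 delta2 n D v a' b' c f) => //; first lra.
    have -> : delta2 * (D - n) = n * (delta2 * e) by rewrite /D; ring.
    rewrite de; nra.
  move=> s u t s0 su ut td mid; rewrite -V_eq; apply: sup_div_ubound.
    have sd : 0 <= s <= mdist a' b' by apply/andP; split; lra.
    have ud : 0 <= u <= mdist a' b' by apply/andP; split; lra.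
    have td' : 0 <= t <= mdist a' b' by apply/andP; split; lra.
    rewrite /dist_pair !(geodesic_mdist fP)// lt_min !normr_gt0 !subr_eq0.
    by rewrite gt_eqF// lt_eqF.
  split; last exact: Qf.
  rewrite (geodesic_mdist fP); try (apply/andP; split; lra).
  by rewrite distrC gtr0_norm; nra.
(* Indeed [delta1 * r <= r / 2 < n]. *)
have sub : ball c (delta1 * r - gamma1) `<=` ball c n.
  move=> y; rewrite !ballEmdist/= => cy; nra.
have := joined_trans (joined_trans ja (joined_subset sub jm)) jb.
move=> /div_at_le/le_trans; apply.
rewrite -EFinM -!EFinD lee_fin; nra.
Qed.

End Divergence.

(** * Comparison of the divergence functions with one another *)

Section Equivalences.
Context {R : realType} {X : metricType R}.
Implicit Types (a b c : X) (G : X -> X -> set X).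

(** Serves even when [f <= g] pointwise: [fun_le] evaluates [g] at [K * n], and passing through [u]
    and [w] avoids a monotonicity argument. *)
Lemma fun_le_trans_le (u w f g : R -> \bar R) : (forall n, f n <= u n)%E ->
  (forall n, w n <= g n)%E -> fun_le u w -> fun_le f g.
Proof.
move=> fu wg [K K1 uw]; exists K => // n n0.
apply: le_trans (fu n) (le_trans (uw n n0) _).
apply: leeD => //; apply: leeD => //; apply: lee_wpmul2l => //.
by rewrite lee_fin; lra.
Qed.

(** The geodesic chosen from [f s] to [f t] lies in [G a b], so its point at distance [u - s] from
    [f s] is some [f x]. The distances to [f s] and [f t] force [x = u]. *)
Lemma geodesic_choice_param G a b : geodesic_choice G ->
  exists2 f, geodesic_param a b f &
    forall s u t, 0 <= s -> s < u -> u < t -> t <= mdist a b ->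
      G (f s) (f t) (f u).
Proof.
move=> [Ggeo Gsub]; have [f [f0 f1 fiso Gf]] := Ggeo a b.
have fP : geodesic_param a b f by [].
exists f => // s u t s0 su ut td.
have sI : 0 <= s <= mdist a b by apply/andP; split; lra.
have tI : 0 <= t <= mdist a b by apply/andP; split; lra.
have Gs : G a b (f s) by rewrite Gf; exists s; rewrite //= in_itv.
have Gt : G a b (f t) by rewrite Gf; exists t; rewrite //= in_itv.
have [k [k0 k1 kiso Gk]] := Ggeo (f s) (f t).
have kP : geodesic_param (f s) (f t) k by [].
have st : mdist (f s) (f t) = t - s.
  by rewrite (geodesic_mdist fP)// distrC gtr0_norm; lra.
have Gv : G (f s) (f t) (k (u - s)).
  by rewrite Gk; exists (u - s); rewrite //= in_itv/= st; apply/andP; split; lra.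
have := Gsub _ _ _ _ Gs Gt _ Gv; rewrite Gf => -[x]; rewrite /= in_itv/= => xI fx.
have uI : 0 <= u - s <= mdist (f s) (f t) by rewrite st; apply/andP; split; lra.
have sx : `|s - x| = u - s.
  rewrite -(geodesic_mdist fP)// fx -[f s in LHS]k0.
  rewrite (geodesic_mdist kP)//; first by rewrite sub0r normrN gtr0_norm; lra.
  by rewrite lexx mdist_ge0.
have tx : `|t - x| = t - u.
  rewrite -(geodesic_mdist fP)// fx -[f t in LHS]k1 st.
  rewrite st in uI; rewrite (geodesic_mdist kP) ?st//.
    by rewrite gtr0_norm; lra.
  by rewrite lexx andbT; lra.
suff -> : u = x by rewrite fx.
by move: sx tx; case: (ger0P (s - x)); case: (ger0P (t - x)); lra.
Qed.

(** For [c] equidistant from the ends, the triangle inequality gives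
    [mdist a b <= 2 * dist_pair c a b]. *)
Lemma div_mid_le_div' G gamma lambda delta n : 2 <= lambda ->
  (div_mid G gamma delta n <= div' G gamma lambda delta n)%E.
Proof.
move=> l2; apply: sup_div_le; first exact: sup_div_ge0.
move=> a b c r0 [abn Gabc ca]; apply: sup_div_ubound => //; split=> //.
move: r0; rewrite /dist_pair ca minxx => r0.
have := metric_triangle a c b; rewrite (metric_sym a c) ca; nra.
Qed.

Lemma div'_le_div G gamma lambda delta n :
  (div' G gamma lambda delta n <= div X gamma lambda delta n)%E.
Proof. by apply: subset_sup_div => a b c []. Qed.

Lemma div_le_Div gamma lambda delta n :
  (div X gamma lambda delta n <= Div X gamma delta n)%E.
Proof. by apply: subset_sup_div => a b c []. Qed.

Lemma div'_le_Div' G gamma lambda delta n :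
  (div' G gamma lambda delta n <= Div' G gamma delta n)%E.
Proof. by apply: subset_sup_div => a b c []. Qed.

Lemma Div'_le_Div G gamma delta n :
  (Div' G gamma delta n <= Div X gamma delta n)%E.
Proof. by apply: subset_sup_div => a b c []. Qed.

End Equivalences.

Theorem corollary3p12 (R : realType) (X : metricType R)
  (X_geodesic : geodesic_space X) (X_proper : proper_space X)
  (X_one_ended : one_ended X) (X_periodic : periodic_space X)
  (kappa : R)
  (near_line : forall x : X, exists (L : R) (p : R -> X),
     [/\ 1 <= L, bilipschitz_line L p & exists t, mdist x (p t) < kappa])
  (C : R) (C_ge1 : 1 <= C)
  (m : nat) (p : 'I_m -> R -> X)
  (p_line : forall i, bilipschitz_line C (p i))
  (near_p : forall x : X, exists (g : X -> X) (i : 'I_m),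
     is_isometry g /\ exists t, mdist x (g (p i t)) < kappa) :
  let gamma0 := 4 * kappa in
  let delta0 := 1 / (C ^+ 2 + 1) in
  [/\ (* (1) *)
      forall gamma delta, gamma0 <= gamma -> 0 < delta <= delta0 ->
      forall G1 G2 : X -> X -> set X,
        geodesic_choice G1 -> geodesic_choice G2 ->
        (forall lambda, 2 <= lambda ->
           fun_equiv (div' G1 gamma lambda delta) (div' G2 gamma lambda delta))
        /\ fun_equiv (Div' G1 gamma delta) (Div' G2 gamma delta),
      (* (2), the equivalences *)
      forall gamma delta lambda, gamma0 <= gamma -> 0 < delta <= delta0 ->
        2 <= lambda ->
      forall G : X -> X -> set X, geodesic_choice G ->
        [/\ fun_equiv (Div X gamma delta) (Div' G gamma delta),
            fun_equiv (Div' G gamma delta) (div X gamma lambda delta)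
          & fun_equiv (div X gamma lambda delta) (div' G gamma lambda delta)],
      (* (2), the independence of delta and gamma *)
      forall gamma1 gamma2 delta1 delta2 lambda,
        gamma0 <= gamma1 -> gamma0 <= gamma2 ->
        0 < delta1 <= delta0 -> 0 < delta2 <= delta0 -> 2 <= lambda ->
        [/\ fun_equiv (Div X gamma1 delta1) (Div X gamma2 delta2),
            fun_equiv (div X gamma1 lambda delta1) (div X gamma2 lambda delta2)
          & forall G : X -> X -> set X, geodesic_choice G ->
              fun_equiv (Div' G gamma1 delta1) (Div' G gamma2 delta2) /\
              fun_equiv (div' G gamma1 lambda delta1)
                        (div' G gamma2 lambda delta2)]
    & (* (3) *)
      forall gamma delta, gamma0 <= gamma -> 0 < delta <= delta0 ->
      forall G : X -> X -> set X, geodesic_choice G ->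
        fun_equiv (Div X gamma delta) (div' G gamma 2 delta) /\
        fun_equiv (Div X gamma delta) (div_mid G gamma delta)].
Proof.
move=> gamma0 delta0.
(* Periodicity provides a point of [X], whence [kappa] is positive; isometries carry the lines [p i]
   to [C]-bi-Lipschitz lines. *)
have [k0 near] : 0 < kappa /\ forall x : X, exists (q : R -> X) (t : R),
    bilipschitz_line C q /\ mdist x (q t) < kappa.
  split=> [|x].
    have [x _] := X_periodic; have [L [q [_ _ [t]]]] := near_line x.
    by apply: le_lt_trans; apply: mdist_ge0.
  have [g [i [giso [t xt]]]] := near_p x; exists (g \o p i), t; split=> //.
  exact: bilipschitz_line_isometry.
have delta0_le1 : delta0 <= 1.
  have C2 : 0 <= C ^+ 2 by apply: sqr_ge0.
  by rewrite /delta0 ler_pdivrMr; lra.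
have Div_le_div_mid (G : X -> X -> set X) gamma1 gamma2 delta1 delta2 : geodesic_choice G ->
    gamma0 <= gamma1 -> gamma0 <= gamma2 ->
    0 < delta1 <= delta0 -> 0 < delta2 <= delta0 ->
    fun_le (Div X gamma1 delta1) (div_mid G gamma2 delta2).
  move=> GP g1 g2 d1 /andP[d2 d2'].
  pose Q (a b c : X) := G a b c /\ mdist c a = mdist c b.
  suff DQ : fun_le (Div X gamma1 delta1)
      (fun n => sup_div gamma2 delta2 (fun a b c => mdist a b <= n /\ Q a b c)).
    apply: fun_le_trans_le DQ => n //.
    by apply: subset_sup_div => a b c [abn [Gabc ca]].
  apply: (@Div_fun_le _ _ kappa C gamma1 gamma2 delta1 delta2 Q) => //.
  - by move: g2; rewrite /gamma0; lra.
  - by rewrite d2; lra.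
  move=> a b; have [f fP Gf] := geodesic_choice_param a b GP.
  exists f => // s u t s0 su ut td mid; split; first exact: Gf.
  rewrite !(geodesic_mdist fP); try (apply/andP; split; lra).
  by rewrite gtr0_norm ?subr_gt0// mid distrC gtr0_norm// subr_gt0.
(* The independence of [Div] and [div] is stated without a choice of geodesics, so [div_mid] is not
   at hand there. Midpoints also satisfy the condition with [lambda], which involves no choice. *)
have Div_le_div gamma1 gamma2 delta1 delta2 lambda : 2 <= lambda ->
    gamma0 <= gamma1 -> gamma0 <= gamma2 ->
    0 < delta1 <= delta0 -> 0 < delta2 <= delta0 ->
    fun_le (Div X gamma1 delta1) (div X gamma2 lambda delta2).
  move=> l2 g1 g2 d1 /andP[d2 d2'].
  apply: (Div_fun_le (kappa := kappa) (C := C)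
    (Q := fun a b c => mdist a b <= lambda * dist_pair c a b)) => //.
  - by move: g2; rewrite /gamma0; lra.
  - by rewrite d2; lra.
  move=> a b; have [f fP] := geodesic_space_param a b X_geodesic.
  exists f => // s u t s0 su ut td mid.
  rewrite /dist_pair !(geodesic_mdist fP); try (apply/andP; split; lra).
  rewrite (distrC u t) (gtr0_norm (x := u - s)) ?subr_gt0//.
  rewrite (gtr0_norm (x := t - u)) ?subr_gt0// -mid minxx distrC gtr0_norm; nra.
have div'_le gamma lambda delta (G : X -> X -> set X) n :
    (div' G gamma lambda delta n <= Div X gamma delta n)%E.
  exact: le_trans (div'_le_div _ _ _ _ _) (div_le_Div _ _ _ _).
have le_Div' gamma delta (G : X -> X -> set X) n :
    (div_mid G gamma delta n <= Div' G gamma delta n)%E.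
  exact: le_trans (div_mid_le_div' _ _ _ _ (lexx 2)) (div'_le_Div' _ _ _ _ _).
have div'_fun_le (G1 G2 : X -> X -> set X) gamma1 gamma2 lambda delta1 delta2 :
    geodesic_choice G2 -> 2 <= lambda ->
    gamma0 <= gamma1 -> gamma0 <= gamma2 ->
    0 < delta1 <= delta0 -> 0 < delta2 <= delta0 ->
    fun_le (div' G1 gamma1 lambda delta1) (div' G2 gamma2 lambda delta2).
  move=> G2P l2 g1 g2 d1 d2.
  apply: fun_le_trans_le (Div_le_div_mid _ _ _ _ _ G2P g1 g2 d1 d2) => n //.
  exact: div_mid_le_div'.
have Div'_fun_le (G1 G2 : X -> X -> set X) gamma1 gamma2 delta1 delta2 :
     geodesic_choice G2 ->
    gamma0 <= gamma1 -> gamma0 <= gamma2 ->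
    0 < delta1 <= delta0 -> 0 < delta2 <= delta0 ->
    fun_le (Div' G1 gamma1 delta1) (Div' G2 gamma2 delta2).
  move=> G2P g1 g2 d1 d2.
  apply: fun_le_trans_le (Div_le_div_mid _ _ _ _ _ G2P g1 g2 d1 d2) => n //.
  exact: Div'_le_Div.
split.
- move=> gamma delta gP dP G1 G2 G1P G2P; split=> [lambda l2|]; split.
  + exact: div'_fun_le.
  + exact: div'_fun_le.
  + exact: Div'_fun_le.
  + exact: Div'_fun_le.
- move=> gamma delta lambda gP dP l2 G GP.
  have Dm := Div_le_div_mid _ _ _ _ _ GP gP gP dP dP.
  have Dd := Div_le_div _ _ _ _ _ l2 gP gP dP dP.
  split; split.
  + by apply: fun_le_trans_le Dm => n //; apply: le_Div'.
  + by apply: fun_le_trans_le Dm => n; [apply: Div'_le_Div|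
      apply: le_trans (le_Div' _ _ _ _) (Div'_le_Div _ _ _ _)].
  + by apply: fun_le_trans_le Dd => n //; apply: Div'_le_Div.
  + by apply: fun_le_trans_le Dm => n; [apply: div_le_Div|apply: le_Div'].
  + by apply: fun_le_trans_le Dm => n; [apply: div_le_Div|apply: div_mid_le_div'].
  + by apply: fun_le_trans_le Dd => n.
- move=> gamma1 gamma2 delta1 delta2 lambda g1 g2 d1 d2 l2.
  have D12 := Div_le_div _ _ _ _ _ l2 g1 g2 d1 d2.
  have D21 := Div_le_div _ _ _ _ _ l2 g2 g1 d2 d1.
  split=> [||G GP]; split.
  + by apply: fun_le_trans_le D12 => n //; apply: div_le_Div.
  + by apply: fun_le_trans_le D21 => n //; apply: div_le_Div.
  + by apply: fun_le_trans_le D12 => n //; apply: div_le_Div.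
  + by apply: fun_le_trans_le D21 => n //; apply: div_le_Div.
  + by split; apply: Div'_fun_le.
  + by split; apply: div'_fun_le.
- move=> gamma delta gP dP G GP.
  have Dm := Div_le_div_mid _ _ _ _ _ GP gP gP dP dP.
  split; split => //.
  + by apply: fun_le_trans_le Dm => n //; apply: div_mid_le_div'.
  + by apply: fun_le_trans_le Dm => n //; apply: le_trans (div_mid_le_div' _ _ _ _ (lexx 2)) _.
  + by apply: fun_le_trans_le Dm => n //; apply: le_trans (le_Div' _ _ _ _) (Div'_le_Div _ _ _ _).
Qed.
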